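(* Consider the closed-loop system formed by the power network dynamics, the generation and controllable demand dynamics, and the Privacy-Preserving scheme, as specified in the context. Suppose that the privacy-enhancing signals satisfy $n_{k,j}=n^d_{k,j}+n^f_{k,j}$ for all $k\in\mathcal N_j$, $j\in\mathcal N$, where (i) $n^d_{k,j}(t)=-\xi_{k,j}(t)\,\dot p^c_{k,j}(t)$, where the non-negative signal $\xi_{k,j}(t)$ satisfies $\dot\xi_{k,j}(t)<\hat\beta_{k,j}$ for all $t\ge 0$; (ii) $|n^f_{k,j}(t)|\le\beta_{k,j}|\omega_j(t)|$ for all $t\ge0$; and the positive constants $\beta_{k,j},\hat\beta_{k,j}$ satisfy, for all $k\in\mathcal N_j$, $j\in\mathcal N$, $$\begin{bmatrix}-h_{k,j}-D_j/|\mathcal N_j| & h_{k,j}+\beta_{k,j}/2\\ h_{k,j}+\beta_{k,j}/2 & -h_{k,j}+\hat\beta_{k,j}/2\end{bmatrix}\preceq0 .$$ Let also $q_{k,j}(m_{k,j}+h_{k,j})=1$ for all $k\in\mathcal N^G_j$, $j\in\mathcal N$, and $q_{k,j}h_{k,j}=1$ for all $k\in\mathcal N^L_j$, $j\in\mathcal N$. Then the equilibrium values $p^{M,*}=[p^{M,*}_{k,j}]$ and $d^{c,*}=[d^{c,*}_{k,j}]$ of the system (at any equilibrium) globally minimize the optimization problem $$\min_{p^M,d^c}\ \sum_{j\in\mathcal N}\Big(\sum_{k\in\mathcal N^G_j}\tfrac12 q_{k,j}(p^M_{k,j})^2+\sum_{k\in\mathcal N^L_j}\tfrac12 q_{k,j}(d^c_{k,j})^2\Big)$$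 $$\text{subject to}\quad \sum_{j\in\mathcal N}\Big(\sum_{k\in\mathcal N^G_j}p^M_{k,j}-\sum_{k\in\mathcal N^L_j}d^c_{k,j}-\sum_{k\in\mathcal N_j}p^L_{k,j}\Big)=0 .$$
   Context: Network. $(\mathcal N,\mathcal E)$ is a finite connected graph (buses and lines), with an arbitrary orientation of its edges, so that $(i,j)\in\mathcal E$ implies $(j,i)\notin\mathcal E$. For $j\in\mathcal N$, $\mathcal N^p_j=\{k:(k,j)\in\mathcal E\}$ and $\mathcal N^s_j=\{k:(j,k)\in\mathcal E\}$. At each bus $j$ there is a finite set $\mathcal N^G_j$ of generation units and a finite set $\mathcal N^L_j$ of controllable loads (disjoint), and $\mathcal N_j=\mathcal N^G_j\cup\mathcal N^L_j$ is the set of active units at bus $j$. Units are indexed by pairs $(k,j)$ with $k\in\mathcal N_j$, $j\in\mathcal N$; $\widetilde{\mathcal N}$ is the set of all active units in the network (the union over $j$ of the $\mathcal N_j$). The real numbers $q_{k,j}$ are cost coefficients of the units. Power network dynamics (real-valued, continuous time): $\dot\eta_{ij}=\omega_i-\omega_j$, $(i,j)\in\mathcal E$; $M_j\dot\omega_j=\sum_{k\in\mathcal N^G_j}p^M_{k,j}-\sum_{k\in\mathcal N^L_j}d^c_{k,j}-\sum_{k\in\mathcal N_j}p^L_{k,j}-D_j\omega_j-\sum_{i\in\mathcal N^s_j}p_{ji}+\sum_{i\in\mathcal N^p_j}p_{ij}$, $j\in\mathcal N$; $p_{ij}=B_{ij}\eta_{ij}$, $(i,j)\in\mathcal E$; with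 constants $B_{ij}>0$, $M_j>0$, $D_j>0$, and constant uncontrollable demands $p^L_{k,j}\in\mathbb R$. Generation and controllable demand dynamics: $\tau_{k,j}\dot x_{k,j}=-x_{k,j}+m_{k,j}(u_{k,j}-\omega_j)$ and $p^M_{k,j}=x_{k,j}+h_{k,j}(u_{k,j}-\omega_j)$ for $k\in\mathcal N^G_j$, $j\in\mathcal N$; $d^c_{k,j}=-h_{k,j}(u_{k,j}-\omega_j)$ for $k\in\mathcal N^L_j$, $j\in\mathcal N$; with constants $\tau_{k,j},m_{k,j},h_{k,j}>0$. Prosumption vector: $\widetilde s\in\mathbb R^{|\widetilde{\mathcal N}|}$ has entries $\widetilde s_{k,j}=-p^M_{k,j}+p^L_{k,j}$ for $k\in\mathcal N^G_j$ and $\widetilde s_{k,j}=d^c_{k,j}+p^L_{k,j}$ for $k\in\mathcal N^L_j$. Privacy-Preserving scheme. $(\widetilde{\mathcal N},\widetilde{\mathcal E})$ is a connected (communication) graph with incidence matrix $H\in\mathbb R^{|\widetilde{\mathcal N}|\times|\widetilde{\mathcal E}|}$, where $H_{ie}=+1$ if $i$ is the positive end of edge $e$, $-1$ if $i$ is the negative end of $e$, and $0$ otherwise. The scheme is $\widetilde\Gamma\dot\psi=H^Tp^c$, $\quad\Gamma\dot p^c=\widetilde s-H\psi+n$, $\quad u=p^c$, where $\psi\in\mathbb R^{|\widetilde{\mathcal E}|}$, $p^c=[p^c_{k,j}]\in\mathbb R^{|\widetilde{\mathcal N}|}$, $u=[u_{k,j}]$, $\widetilde\Gamma,\Gamma$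 are diagonal matrices with positive diagonal entries, and $n=[n_{k,j}]$ is a locally Lipschitz privacy-enhancing signal. The signals $\xi_{k,j}$ and $n^f_{k,j}$ are (deterministic) time-dependent signals. An equilibrium is a point $(\eta^*,\psi^*,\omega^*,x^*,p^{c,*})$ at which all time derivatives of the closed-loop system are zero; $p^{M,*}$, $d^{c,*}$ are the values of $p^M$, $d^c$ at that point. $A\preceq0$ means that $A$ is negative semi-definite. *)

(* Defs.v *)
From HB Require Import structures.
From mathcomp Require Export all_boot all_order all_algebra.
From mathcomp Require Export all_classical all_reals all_analysis.
Set Implicit Arguments.
Unset Strict Implicit.
Unset Printing Implicit Defensive.
Import Order.TTheory GRing.Theory Num.Theory.
Import numFieldNormedType.Exports.
Local Open Scope ring_scope.

(* Finite connected simple graph on [T], each edge carrying one of its two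
   orientations; connectedness ignores the orientation. *)
Definition oriented_graph (T : finType) (E : {set T * T}) : Prop :=
  forall i j, (i, j) \in E -> (j, i) \notin E.

Definition connected_graph (T : finType) (E : {set T * T}) : Prop :=
  forall i j, connect (fun a b => ((a, b) \in E) || ((b, a) \in E)) i j.

(* The oriented edge (a, b) has positive end a and negative end b. *)
Definition incidence (R : pzRingType) (T : finType) (i : T) (e : T * T) : R :=
  if i == e.1 then 1 else if i == e.2 then -1 else 0.

Definition neg_semidef (R : numDomainType) (n : nat) (A : 'M[R]_n) : Prop :=
  forall v : 'cV[R]_n, (v^T *m A *m v) 0 0 <= 0.

(* [c f' = r] at time [t].  Signals live on [0, +oo[ but are represented by
   total functions [R -> R]; their values at negative times are irrelevant, up
   to the choice of an extension making the derivative at 0 two-sided. *)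
Definition ode (R : realType) (c : R) (f : R -> R) (t r : R) : Prop :=
  derivable f t 1 /\ c * (f^`() t)%classic = r.

(* Buses form the finite type [N].  [G] and [L] are the finite types of all
   generation units and of all controllable loads, so that [G + L] is the set
   of all active units; an element of [G + L] located at bus j plays the role
   of a pair (k, j). *)
Record grid (R : realType) (N G L : finType) := Grid {
  lines : {set N * N};
  bus : G + L -> N;
  B : N -> N -> R;
  M : N -> R;
  D : N -> R;
  pL : G + L -> R;
  tau : G -> R;
  m : G -> R;
  h : G + L -> R;
  comm : {set (G + L) * (G + L)};
  Gam : G + L -> R;
  Gamt : (G + L) * (G + L) -> R
}.

(* [eta i j] is meaningful only for lines (i, j), and [psi e] only for
   communication edges e: the other values are never used. *)
Record state (R : realType) (N G L : finType) := State {
  eta : N -> N -> R;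
  omega : N -> R;
  x : G -> R;
  psi : (G + L) * (G + L) -> R;
  pc : G + L -> R
}.

Section PowerNetwork.
Variables (R : realType) (N G L : finType) (P : grid R N G L).
Local Notation state := (state R N G L).
Local Notation U := (G + L)%type.

Record grid_wf : Prop := GridWf {
  lines_oriented : oriented_graph (lines P);
  lines_connected : connected_graph (lines P);
  comm_oriented : oriented_graph (comm P);
  comm_connected : connected_graph (comm P);
  B_gt0 : forall i j, (i, j) \in lines P -> 0 < B P i j;
  M_gt0 : forall j, 0 < M P j;
  D_gt0 : forall j, 0 < D P j;
  tau_gt0 : forall k, 0 < tau P k;
  m_gt0 : forall k, 0 < m P k;
  h_gt0 : forall k, 0 < h P k;
  Gam_gt0 : forall k, 0 < Gam P k;
  Gamt_gt0 : forall e, e \in comm P -> 0 < Gamt P e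
}.

Definition preds (j : N) : {set N} := [set k | (k, j) \in lines P].
Definition succs (j : N) : {set N} := [set k | (j, k) \in lines P].
Definition gens (j : N) : {set G} := [set k | bus P (inl k) == j].
Definition loads (j : N) : {set L} := [set k | bus P (inr k) == j].
Definition units (j : N) : {set U} := [set k | bus P k == j].

(* The control input is u = p^c. *)
Definition drive (z : state) (k : U) : R := pc z k - omega z (bus P k).

Definition flow (z : state) (i j : N) : R := B P i j * eta z i j.

Definition pM (z : state) (k : G) : R :=
  x z k + h P (inl k) * drive z (inl k).

Definition dc (z : state) (k : L) : R := - h P (inr k) * drive z (inr k).

Definition prosumption (z : state) (k : U) : R :=
  match k with
  | inl g => - pM z g + pL P (inl g)
  | inr l => dc z l + pL P (inr l)
  end.

Definition power_network (z : R -> state) (t : R) : Prop :=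
  (forall i j, (i, j) \in lines P ->
     ode 1 (fun s => eta (z s) i j) t (omega (z t) i - omega (z t) j)) /\
  (forall j,
     ode (M P j) (fun s => omega (z s) j) t
       (\sum_(k in gens j) pM (z t) k - \sum_(k in loads j) dc (z t) k
        - \sum_(k in units j) pL P k - D P j * omega (z t) j
        - \sum_(i in succs j) flow (z t) j i
        + \sum_(i in preds j) flow (z t) i j)).

Definition generation (z : R -> state) (t : R) : Prop :=
  forall k : G,
    ode (tau P k) (fun s => x (z s) k) t
      (- x (z t) k + m P k * drive (z t) (inl k)).

Definition privacy_preserving (n : U -> R -> R) (z : R -> state) (t : R) :
    Prop :=
  (forall e, e \in comm P ->
     ode (Gamt P e) (fun s => psi (z s) e) t
       (\sum_(k : U) incidence R k e * pc (z t) k)) /\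
  (forall k : U,
     ode (Gam P k) (fun s => pc (z s) k) t
       (prosumption (z t) k
        - \sum_(e in comm P) incidence R k e * psi (z t) e + n k t)).

Definition closed_loop (n : U -> R -> R) (z : R -> state) : Prop :=
  forall t, 0 <= t ->
    [/\ power_network z t, generation z t & privacy_preserving n z t].

(* The system is driven by time-dependent signals: an equilibrium is a point at
   which all time derivatives vanish at every time, that is, a constant
   trajectory. *)
Definition equilibrium (n : U -> R -> R) (zs : state) : Prop :=
  closed_loop n (fun=> zs).

(* Conditions on the privacy-enhancing signals along the trajectory [z]. *)
Record privacy_signals (beta betah : U -> R) (n nd nf xi : U -> R -> R)
    (z : R -> state) : Prop := PrivacySignals {
  n_lipschitz : forall k,
    [locally [lipschitz (n k t) | t in [set t | 0 <= t]%classic]];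
  n_split : forall k t, 0 <= t -> n k t = nd k t + nf k t;
  nd_def : forall k t, 0 <= t ->
    nd k t = - xi k t * ((fun s => pc (z s) k)^`() t)%classic;
  xi_ge0 : forall k t, 0 <= t -> 0 <= xi k t;
  xi_derivable : forall k t, 0 <= t -> derivable (xi k) t 1;
  xi_slope : forall k t, 0 <= t -> ((xi k)^`() t)%classic < betah k;
  nf_bound : forall k t, 0 <= t ->
    `|nf k t| <= beta k * `|omega (z t) (bus P k)|
}.

Definition privacy_lmi (beta betah : U -> R) (k : U) : 'M[R]_(1 + 1) :=
  block_mx
    (- h P k - D P (bus P k) / #|units (bus P k)|%:R)%:M
    (h P k + beta k / 2)%:M
    (h P k + beta k / 2)%:M
    (- h P k + betah k / 2)%:M.

Definition cost (q : U -> R) (p : G -> R) (d : L -> R) : R :=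
  \sum_(j : N) (\sum_(k in gens j) 2^-1 * q (inl k) * p k ^+ 2
                + \sum_(k in loads j) 2^-1 * q (inr k) * d k ^+ 2).

Definition feasible (p : G -> R) (d : L -> R) : Prop :=
  \sum_(j : N) (\sum_(k in gens j) p k - \sum_(k in loads j) d k
                - \sum_(k in units j) pL P k) = 0.

Definition global_minimizer (q : U -> R) (p : G -> R) (d : L -> R) : Prop :=
  feasible p d /\ forall p' d', feasible p' d' -> cost q p d <= cost q p' d'.

End PowerNetwork.

(* Main.v *)
(* At an equilibrium all frequencies agree (the grid is connected), say with
   value w, and all entries of p^c agree (the communication graph is
   connected), say with value c.  Summing the swing equations over the buses
   and the p^c equations over the units cancels all edge terms and gives
   w * (sum of D) = sum of n^f.  The matrix inequality tested on (1, 1) reads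
   beta < D / |N_j|, so that the sum of the beta is less than the sum of the D;
   as |n^f| <= beta |w|, this forces w = 0.  Hence the balance constraint holds,
   and the marginal costs q p^M and - q d^c all equal c, which is the
   optimality condition of the convex problem. *)
Require Import Defs.
From mathcomp Require Import ring lra.
Set Implicit Arguments.
Unset Strict Implicit.
Unset Printing Implicit Defensive.
Import Order.TTheory GRing.Theory Num.Theory.
Import numFieldNormedType.Exports.
Local Open Scope ring_scope.

(** Turns each differential equation of the closed loop into an algebraic one at an equilibrium. *)
Lemma ode_cst (R : realType) (c a t r : R) : ode c (fun=> a) t r -> r = 0.
Proof. by case=> _ <-; rewrite derive1_cst mulr0. Qed.

Lemma connected_graph_cst (T : finType) (A : Type) (E : {set T * T})
    (f : T -> A) :
  connected_graph E -> (forall i j, (i, j) \in E -> f i = f j) ->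
  forall i j, f i = f j.
Proof.
move=> cE fE i j; have /connectP[s + ->] := cE i j.
elim: s i => //= a s IHs i /andP[ia /IHs <-].
by case/orP: ia => /fE.
Qed.

Lemma sum_fibers (V : nmodType) (I J : finType) (f : I -> J) (F : I -> V) :
  \sum_j \sum_(i in [set i | f i == j]) F i = \sum_i F i.
Proof.
rewrite [RHS](partition_big f predT) //=; apply: eq_bigr => j _.
by apply: eq_bigl => i; rewrite inE.
Qed.

Lemma oriented_graph_neq (T : finType) (E : {set T * T}) (e : T * T) :
  oriented_graph E -> e \in E -> e.1 != e.2.
Proof.
case: e => a b oE abE /=; apply/eqP => ab; subst b.
by have := oE _ _ abE; rewrite abE.
Qed.

Lemma sum_incidence (R : pzRingType) (T : finType) (e : T * T) (f : T -> R) :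
  e.1 != e.2 -> \sum_k incidence R k e * f k = f e.1 - f e.2.
Proof.
move=> ne; rewrite (bigD1 e.1) //= (bigD1 e.2) ?[e.2 == _]eq_sym //=.
rewrite /incidence eqxx [e.2 == _]eq_sym (negbTE ne) eqxx mul1r mulN1r.
rewrite big1 ?addr0 // => k /andP[/negbTE-> /negbTE->].
by rewrite mul0r.
Qed.

(** Both sides sum [F] once over each edge of [E], grouped by tail on the left and by head on the
    right. *)
Lemma sum_div_flow (R : zmodType) (T : finType) (E : {set T * T})
    (F : T -> T -> R) :
  \sum_j \sum_(i in [set i | (j, i) \in E]) F j i =
  \sum_j \sum_(i in [set i | (i, j) \in E]) F i j.
Proof.
rewrite (exchange_big_dep predT) //=; apply: eq_bigr => j _.
by apply: eq_bigl => i; rewrite !inE.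
Qed.

Section Equilibrium.
Variables (R : realType) (N G L : finType) (P : grid R N G L).

(** On the vector (1, 1) the terms in [h] cancel, leaving [beta k + betah k / 2 - D / |N_j| <= 0];
    strictness comes from [0 < betah k]. *)
Lemma lmi_beta_lt (beta betah : G + L -> R) (k : G + L) :
  0 < betah k -> neg_semidef (privacy_lmi P beta betah k) ->
  beta k < D P (bus P k) / #|units P (bus P k)|%:R.
Proof.
move=> bh /(_ (const_mx 1)).
(* The block form of the test vector lets the product with [block_mx] be computed blockwise. *)
have -> : (const_mx 1 : 'cV[R]_(1 + 1)) = col_mx 1%:M 1%:M.
  rewrite -col_mx_const; congr col_mx.
    by apply/matrixP => i j; rewrite !mxE !ord1.
  by apply/matrixP => i j; rewrite !mxE !ord1.
rewrite /privacy_lmi tr_col_mx !trmx1 mul_row_block mul_row_col !mul1mx !mulmx1.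
rewrite !mxE /= mulr1n.
set d := _ / _; lra.
Qed.

(** The bus [j0] makes the index set nonempty; otherwise both sums would be 0 and the inequality not
    strict. *)
Lemma sum_beta_lt (beta : G + L -> R) (j0 : N) :
  grid_wf P ->
  (forall k, beta k < D P (bus P k) / #|units P (bus P k)|%:R) ->
  \sum_k beta k < \sum_j D P j.
Proof.
move=> hP hb; rewrite -(sum_fibers (bus P)).
apply: ltr_sum => [|j _].
  by apply/hasP; exists j0; rewrite ?mem_index_enum.
rewrite -/(units P j).
(* A bus without units contributes 0 on the left and a positive damping on the right. Elsewhere
   [D P j] splits into equal shares, one per unit. *)
have [U0|[k0 k0j]] := set_0Vmem (units P j).
  by rewrite U0 big_set0; exact: D_gt0.
have -> : D P j = \sum_(k in units P j) D P j / #|units P j|%:R.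
  rewrite sumr_const -[RHS]mulr_natr divfK // pnatr_eq0 -lt0n.
  by apply/card_gt0P; exists k0.
apply: ltr_sum => [|k]; first by apply/hasP; exists k0; rewrite ?mem_index_enum.
by rewrite inE => /eqP <-.
Qed.

Lemma costE (q : G + L -> R) p d :
  cost P q p d = \sum_k 2^-1 * q (inl k) * p k ^+ 2
               + \sum_k 2^-1 * q (inr k) * d k ^+ 2.
Proof. by rewrite /cost big_split /= !sum_fibers. Qed.

Lemma imbalanceE (p : G -> R) (d : L -> R) :
  \sum_(j : N) (\sum_(k in gens P j) p k - \sum_(k in loads P j) d k
                - \sum_(k in units P j) pL P k)
  = \sum_k p k - \sum_k d k - \sum_k pL P k.
Proof. by rewrite !sumrB !sum_fibers. Qed.

Lemma sum_prosumption (z : state R N G L) :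
  \sum_k prosumption P z k
  = - (\sum_k pM P z k - \sum_k dc P z k - \sum_k pL P k).
Proof.
rewrite !big_sumType /= big_split [X in _ + X]big_split /= sumrN; ring.
Qed.

(** By convexity each cost lies above its tangent. The slopes are [c] and [- c], so the linear terms
    add up to [c] times the change of total generation minus total load, which is zero between
    feasible points. *)
Lemma equal_marginal_costs_minimize (q : G + L -> R) (c : R) p d :
  (forall k, 0 <= q k) ->
  (forall k, q (inl k) * p k = c) -> (forall k, q (inr k) * d k = - c) ->
  feasible P p d -> global_minimizer P q p d.
Proof.
move=> q0 qp qd fpd; split=> // p' d' fpd'.
have tangent (a y y' : R) : 0 <= a ->
    2^-1 * a * y ^+ 2 + a * y * (y' - y) <= 2^-1 * a * y' ^+ 2.
  by move=> a0; have := mulr_ge0 a0 (sqr_ge0 (y' - y)); rewrite !expr2; lra.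
move: fpd fpd'; rewrite /feasible !imbalanceE !costE => fpd fpd'.
have dp : \sum_k (2^-1 * q (inl k) * p k ^+ 2 + c * (p' k - p k))
    <= \sum_k 2^-1 * q (inl k) * p' k ^+ 2.
  by apply: ler_sum => k _; rewrite -(qp k); exact: tangent.
have dd : \sum_k (2^-1 * q (inr k) * d k ^+ 2 + - c * (d' k - d k))
    <= \sum_k 2^-1 * q (inr k) * d' k ^+ 2.
  by apply: ler_sum => k _; rewrite -(qd k); exact: tangent.
move: dp dd; rewrite !big_split /= -!mulr_sumr !sumrB.
set Cp := \sum_k 2^-1 * q (inl k) * p k ^+ 2.
set Cd := \sum_k 2^-1 * q (inr k) * d k ^+ 2.
have -> : \sum_k p' k = \sum_k p k - \sum_k d k + \sum_k d' k by lra.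
lra.
Qed.

Lemma equilibrium_omega (n : G + L -> R -> R) (zs : state R N G L) :
  grid_wf P -> equilibrium P n zs -> forall i j, omega zs i = omega zs j.
Proof.
move=> hP /(_ 0 (lexx _))[[heta _] _ _].
apply: connected_graph_cst (lines_connected hP) _ => i j /heta /ode_cst.
by move/eqP; rewrite subr_eq0 => /eqP.
Qed.

Lemma equilibrium_pc (n : G + L -> R -> R) (zs : state R N G L) :
  grid_wf P -> equilibrium P n zs -> forall k l, pc zs k = pc zs l.
Proof.
move=> hP /(_ 0 (lexx _))[_ _ [hpsi _]].
apply: connected_graph_cst (comm_connected hP) _ => k l kl.
have /ode_cst := hpsi _ kl; rewrite sum_incidence.
  by move/eqP; rewrite subr_eq0 => /eqP.
exact: oriented_graph_neq (comm_oriented hP) kl.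
Qed.

Lemma equilibrium_damping (n : G + L -> R -> R) (zs : state R N G L) :
  equilibrium P n zs ->
  \sum_k pM P zs k - \sum_k dc P zs k - \sum_k pL P k
  = \sum_j D P j * omega zs j.
Proof.
move=> /(_ 0 (lexx _))[[_ homega] _ _].
have : \sum_j
    (\sum_(k in gens P j) pM P zs k - \sum_(k in loads P j) dc P zs k
     - \sum_(k in units P j) pL P k - D P j * omega zs j
     - \sum_(i in succs P j) flow P zs j i
     + \sum_(i in preds P j) flow P zs i j) = 0.
  by apply: big1 => j _; apply: ode_cst (homega j).
rewrite big_split /= sumrB sumrB imbalanceE sum_div_flow subrK.
by move/eqP; rewrite subr_eq0 => /eqP.
Qed.

Lemma equilibrium_noise (n : G + L -> R -> R) (zs : state R N G L) :
  grid_wf P -> equilibrium P n zs ->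
  \sum_k n k 0 = - \sum_k prosumption P zs k.
Proof.
move=> hP /(_ 0 (lexx _))[_ _ [_ hpc]].
have : \sum_k (prosumption P zs k
    - \sum_(e in comm P) incidence R k e * psi zs e + n k 0) = 0.
  by apply: big1 => k _; apply: ode_cst (hpc k).
rewrite big_split /= sumrB exchange_big /= [X in _ - X]big1 => [|e ee].
  by rewrite subr0 addrC => /eqP; rewrite addr_eq0 => /eqP.
(* Each column of the incidence matrix sums to zero. *)
rewrite (sum_incidence (fun=> psi zs e)) ?subrr //.
exact: oriented_graph_neq (comm_oriented hP) ee.
Qed.

Lemma equilibrium_omega0 (beta betah : G + L -> R)
    (n nd nf xi : G + L -> R -> R) (zs : state R N G L) :
  grid_wf P -> (forall k, 0 < betah k) ->
  (forall k, neg_semidef (privacy_lmi P beta betah k)) ->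
  equilibrium P n zs ->
  privacy_signals P beta betah n nd nf xi (fun=> zs) ->
  forall j, omega zs j = 0.
Proof.
move=> hP hbetah hlmi hzs hn j0; set w := omega zs j0.
have wE j : omega zs j = w by exact: equilibrium_omega hP hzs _ _.
have hsum : w * \sum_j D P j = \sum_k nf k 0.
  transitivity (\sum_k n k 0).
    rewrite (equilibrium_noise hP hzs) sum_prosumption opprK.
    rewrite (equilibrium_damping hzs) mulr_sumr.
    by apply: eq_bigr => j _; rewrite wE mulrC.
  (* Along a constant trajectory the derivative of [pc] vanishes, so [nd] does too and only [nf]
     remains. *)
  apply: eq_bigr => k _; rewrite (n_split hn) // (nd_def hn) //=.
  by rewrite derive1_cst mulr0 add0r.
have ltbD := sum_beta_lt j0 hP (fun k => lmi_beta_lt (hbetah k) (hlmi k)).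
have D0 : 0 <= \sum_j D P j by apply: sumr_ge0 => j _; exact/ltW/D_gt0.
have : `|w| * \sum_j D P j <= `|w| * \sum_k beta k.
  rewrite -{1}(ger0_norm D0) -normrM hsum.
  apply: le_trans (ler_norm_sum _ _ _) _; rewrite mulr_sumr.
  apply: ler_sum => k _; rewrite mulrC -(wE (bus P k)).
  exact: (nf_bound hn).
(* If [w] were nonzero, cancelling [|w|] would contradict [ltbD]. *)
have [//|w0] := eqVneq w 0.
by rewrite ler_pM2l ?normr_gt0 // leNgt ltbD.
Qed.

End Equilibrium.

Theorem proposition6 (R : realType) (N G L : finType) (P : grid R N G L)
    (q : G + L -> R) (beta betah : G + L -> R)
    (n nd nf xi : G + L -> R -> R) (zs : state R N G L)
    (hP : grid_wf P)
    (hbeta : forall k, 0 < beta k) (hbetah : forall k, 0 < betah k)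
    (hlmi : forall k, neg_semidef (privacy_lmi P beta betah k))
    (hqG : forall k : G, q (inl k) * (m P k + h P (inl k)) = 1)
    (hqL : forall k : L, q (inr k) * h P (inr k) = 1)
    (hzs : equilibrium P n zs)
    (hn : privacy_signals P beta betah n nd nf xi (fun=> zs)) :
  global_minimizer P q (pM P zs) (dc P zs).
Proof.
have w0 := equilibrium_omega0 hP hbetah hlmi hzs hn.
have [c pcE] : exists c, forall k, pc zs k = c.
  (* With no unit at all, any constant serves as the common value. *)
  have [k0 _|noU] := pickP (@predT (G + L)).
    by exists (pc zs k0) => k; exact: equilibrium_pc hP hzs _ _.
  by exists 0 => k; have := noU k.
have driveE k : drive P zs k = c by rewrite /drive pcE w0 subr0.
have inv_gt0 (a b : R) : 0 < b -> a * b = 1 -> 0 <= a.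
  by move=> b0 ab; rewrite -(pmulr_lge0 _ b0) ab.
apply: (@equal_marginal_costs_minimize _ _ _ _ _ _ c).
- case=> k.
    by apply: inv_gt0 (hqG k); rewrite addr_gt0 ?(m_gt0 hP) ?(h_gt0 hP).
  by apply: inv_gt0 (hqL k); exact: h_gt0.
- move=> k; have [_ /(_ k) /ode_cst + _] := hzs 0 (lexx _).
  rewrite /pM !driveE => xE.
  (* Hence [pM] is [(m + h) * c], and [hqG] makes the marginal cost equal to [c]. *)
  have -> : x zs k = m P k * c by lra.
  by rewrite -mulrDl mulrA hqG mul1r.
- by move=> k; rewrite /dc driveE mulNr mulrN mulrA hqL mul1r.
- rewrite /feasible imbalanceE (equilibrium_damping hzs).
  by apply: big1 => j _; rewrite w0 mulr0.
Qed.
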